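(* Let $q\in[0,1)$ and let $T(z)=\sum_{k=0}^\infty T_kz^k$ be a $\mathbb C^{n\times m}$-valued power series converging in a neighbourhood of the origin. The following are equivalent: (1) there exist $N\in\mathbb N_0$ and $(C,A,B)\in\mathbb C^{n\times N}\times\mathbb C^{N\times N}\times\mathbb C^{N\times m}$ with $T(z)=C\prod_{j=0}^\infty(I_N-(1-q)zq^jA)^{-1}B$ near the origin; (2) the block Hankel matrix $H=\bigl([i+j]_q!\,T_{i+j}\bigr)_{i,j=0}^\infty$ has finite rank; (3) there exist $N\in\mathbb N_0$ and $(C,A,B)$ as in (1) with $T_k=\frac{CA^kB}{[k]_q!}$ for all $k\ge0$; (4) the linear span of the columns of the functions $R_q^kT$, $k=0,1,2,\ldots$, is finite dimensional.
   Context: $[0]_q=1$, $[k]_q=1+q+\cdots+q^{k-1}$ ($k\ge1$), $[k]_q!=\prod_{j=1}^k[j]_q$, $[0]_q!=1$; convention $q^0=1$. For $q\in(0,1)$, $(R_qf)(z)=\frac{f(z)-f(qz)}{(1-q)z}$; $R_0$ is the backward shift $(R_0f)(z)=\frac{f(z)-f(0)}{z}$, $(R_0f)(0)=f'(0)$; applied entrywise. *)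

(* Defs.v *)
(* Complex numbers are R[i] (mathcomp
   real-closed [complex]) over an abstract R : realType, equipped with the
   topology / normed structure of a numFieldType (norm = complex modulus). *)
From HB Require Import structures.
From mathcomp Require Import all_boot all_order all_algebra.
From mathcomp Require Import complex.
From mathcomp Require Import all_classical all_reals all_analysis.
Import Order.TTheory GRing.Theory Num.Theory.
Import numFieldTopology.Exports numFieldNormedType.Exports.

Set Implicit Arguments.
Unset Strict Implicit.
Unset Printing Implicit Defensive.

Local Open Scope ring_scope.
Local Open Scope complex_scope.

(* The complex numbers over R, seen as a numeric closed field
   (hence a topological / normed field). *)
Definition Cx (R : realType) : numClosedFieldType := R[i].

Section QDefs.
Variable R : realType.
Local Notation C := (Cx R).

Definition qint (q : R) (k : nat) : R := \sum_(i < k) q ^+ i.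

Definition qfact (q : R) (k : nat) : R := \prod_(j < k) qint q j.+1.

(* A^k for a square matrix of arbitrary size N (including N = 0) *)
Definition mxpow (N : nat) (A : 'M[C]_N) (k : nat) : 'M[C]_N :=
  iter k (mulmx A) 1%:M.

Definition pseries_conv (n m : nat) (T : nat -> 'M[C]_(n, m)) (z : C) : Prop :=
  forall i j, cvgn (series (fun k => T k i j * z ^+ k)).

Definition pseries_val (n m : nat) (T : nat -> 'M[C]_(n, m)) (z : C)
  : 'M[C]_(n, m) :=
  \matrix_(i, j) limn (series (fun k => T k i j * z ^+ k)).

Definition qfactor (q : R) (N : nat) (A : 'M[C]_N) (z : C) (j : nat)
  : 'M[C]_N :=
  1%:M - (((1 - q) * q ^+ j)%:C * z) *: A.

Definition qprod_partial (q : R) (N : nat) (A : 'M[C]_N) (z : C) (J : nat)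
  : 'M[C]_N :=
  \big[mulmx/1%:M]_(j < J) invmx (qfactor q A z j).

Definition qprod_conv (q : R) (N : nat) (A : 'M[C]_N) (z : C) : Prop :=
  forall i j, cvgn (fun J => qprod_partial q A z J i j).

Definition qprod_val (q : R) (N : nat) (A : 'M[C]_N) (z : C) : 'M[C]_N :=
  \matrix_(i, j) limn (fun J => qprod_partial q A z J i j).

(* R_q on scalar functions: (f(z) - f(qz)) / ((1-q) z) for z <> 0, and
   f'(0) (complex derivative) at z = 0.  For q = 0 this is the backward
   shift (f(z) - f(0))/z with value f'(0) at 0. *)
Definition Rq (q : R) (f : C -> C) (z : C) : C :=
  if z == 0 then 'D_1 f 0 else (f z - f (q%:C * z)) / ((1 - q)%:C * z).

Definition RqM (q : R) (n m : nat) (F : C -> 'M[C]_(n, m)) : C -> 'M[C]_(n, m) :=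
  fun z => \matrix_(i, j) Rq q (fun w => F w i j) z.

Definition finite_dim_span (X I : Type) (D : X -> Prop) (f : I -> X -> C)
  : Prop :=
  exists d (g : 'I_d -> X -> C),
    forall i, exists w : 'I_d -> C,
      forall x, D x -> f i x = \sum_(l < d) w l * g l x.

(* The block Hankel matrix ([i+j]_q! T_{i+j})_{i,j>=0}; rows indexed by
   (block row i, row a < n), columns by (block column j, column b < m). *)
Definition qHankel (q : R) (n m : nat) (T : nat -> 'M[C]_(n, m))
  (r : nat * 'I_n) (c : nat * 'I_m) : C :=
  (qfact q (r.1 + c.1))%:C * T (r.1 + c.1) r.2 c.2.

Definition finite_rank (X Y : Type) (H : X -> Y -> C) : Prop :=
  finite_dim_span (fun _ : X => True) (fun (c : Y) (r : X) => H r c).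

End QDefs.

(* Main.v *)
Require Import Defs.
From HB Require Import structures.
From mathcomp Require Import all_boot all_order all_algebra.
From mathcomp Require Import complex.
From mathcomp Require Import all_classical all_reals all_analysis.
Import Order.TTheory GRing.Theory Num.Theory.
Import numFieldTopology.Exports numFieldNormedType.Exports.
Local Open Scope ring_scope.
Local Open Scope complex_scope.

(** Ho-Kalman theory for the moments M_k = [k]_q! T_k: if finitely many columns
    of the Hankel matrix (M_{i+j}) span all of them, the block shift acts on these
    columns by a matrix A, whence M_k = C A^k B.  Since R_q maps sum a_k z^k to
    sum [k+1]_q a_{k+1} z^k, the columns of R_q^k T have as Taylor coefficients,
    up to the factors 1/[j]_q!, the k-th block column of the Hankel matrix, so (2)
    and (4) express the same linear relations.  Finally E(z) = sum A^k z^k / [k]_q!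
    satisfies E(qz) = (I - (1-q) z A) E(z); iterating and letting q^J z tend to 0
    identifies E with the infinite product, so (1) and (3) agree by uniqueness of
    Taylor coefficients. *)

(** * Finite spanning subfamilies *)

(** Induction on the codimension [d - \rank]: a row [w y] outside the current span, once adjoined,
    strictly raises the rank, which never exceeds [d]. *)
Lemma finite_row_span (K : fieldType) (Y : Type) (d : nat) (w : Y -> 'rV[K]_d) :
  exists p (c : 'I_p -> Y), forall y, (w y <= \matrix_(i < p) w (c i))%MS.
Proof.
suff H k p (c : 'I_p -> Y) : (d - \rank (\matrix_(i < p) w (c i)) <= k)%N ->
    exists p' (c' : 'I_p' -> Y), forall y, (w y <= \matrix_(i < p') w (c' i))%MS.
  pose c0 (i : 'I_0) : Y := match i with Ordinal _ h => False_rect Y (notF h) end.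
  by apply: (H d 0%N c0); exact: leq_subr.
elim: k p c => [|k IH] p c.
  rewrite leqn0 subn_eq0 => le_d; exists p, c => y; apply: submx_full.
  by rewrite /row_full eqn_leq rank_leq_col.
move=> le_k; case: (pselect (forall y, (w y <= \matrix_(i < p) w (c i))%MS)).
  by move=> ok; exists p, c.
move=> /existsNP[y /negP ny].
pose c' (i : 'I_p.+1) := if unlift ord0 i is Some j then c j else y.
apply: (IH _ c').
suff lt_rk : (\rank (\matrix_(i < p) w (c i)) < \rank (\matrix_(i < p.+1) w (c' i)))%N.
  by rewrite -ltnS (leq_trans _ le_k) // ltn_sub2l // (leq_trans lt_rk) // rank_leq_col.
apply: rank_ltmx; rewrite ltmxE; apply/andP; split.
  apply/row_subP => i; rewrite rowK.
  have -> : w (c i) = row (lift ord0 i) (\matrix_(j < p.+1) w (c' j)).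
    by rewrite rowK /c' liftK.
  exact: row_sub.
apply: contra ny => sub; apply: submx_trans sub.
have -> : w y = row ord0 (\matrix_(j < p.+1) w (c' j)).
  by rewrite rowK /c' unlift_none.
exact: row_sub.
Qed.

(** Any relation between the coefficient vectors of the [f i] in terms of [g] also holds between the
    functions on [D], so it suffices to select finitely many coefficient vectors spanning all of
    them. *)
Lemma finite_dim_span_subfamily (R : realType) (X I : Type) (D : X -> Prop)
    (f : I -> X -> Cx R) : finite_dim_span D f ->
  exists p (c : 'I_p -> I), forall i, exists w : 'I_p -> Cx R,
    forall x, D x -> f i x = \sum_(l < p) w l * f (c l) x.
Proof.
move=> [d [g /choice[w fE]]].
have [p [c spanc]] := finite_row_span _ _ _ (fun i => \row_l w i l).
exists p, c => i; have /submxP[A wA] := spanc i.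
exists (A 0) => x Dx; rewrite fE //.
under [RHS]eq_bigr do rewrite fE // mulr_sumr.
rewrite exchange_big /=; apply: eq_bigr => k _.
have /rowP/(_ k) := wA; rewrite !mxE => ->; rewrite mulr_suml.
by apply: eq_bigr => l _; rewrite !mxE mulrA.
Qed.

Lemma mxpowS (R : realType) N (A : 'M[Cx R]_N) k :
  mxpow A k.+1 = A *m mxpow A k.
Proof. by []. Qed.

Lemma mxpowD (R : realType) N (A : 'M[Cx R]_N) i j :
  mxpow A (i + j) = mxpow A i *m mxpow A j.
Proof. by elim: i => [|i IH]; rewrite ?mul1mx // addSn !mxpowS IH mulmxA. Qed.

(** * q-factorials and Ho-Kalman realization *)

Section Qfact.
Context (R : realType) (q : R).
Hypothesis q_ge0 : 0 <= q.

Lemma qintS_ge1 k : 1 <= qint q k.+1.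
Proof. by rewrite /qint big_ord_recl expr0 lerDl sumr_ge0 // => i _; apply: exprn_ge0. Qed.

Lemma qfactS k : qfact q k.+1 = qfact q k * qint q k.+1.
Proof. by rewrite /qfact big_ord_recr. Qed.

Lemma qfact_ge1 k : 1 <= qfact q k.
Proof.
elim: k => [|k IH]; first by rewrite /qfact big_ord0.
by rewrite qfactS mulr_ege1 // qintS_ge1.
Qed.

Lemma qfact_neq0 k : (qfact q k)%:C != 0 :> Cx R.
Proof. by rewrite fmorph_eq0 gt_eqF // (lt_le_trans ltr01) // qfact_ge1. Qed.

Lemma qfactVM k (x : Cx R) : ((qfact q k)^-1)%:C * ((qfact q k)%:C * x) = x.
Proof. by rewrite fmorphV mulKf // qfact_neq0. Qed.

Lemma qfactMV k (x : Cx R) : (qfact q k)%:C * (((qfact q k)^-1)%:C * x) = x.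
Proof. by rewrite fmorphV mulVKf // qfact_neq0. Qed.

Variables (n m : nat) (T : nat -> 'M[Cx R]_(n, m)).

Lemma qHankelE i a j b :
  qHankel q T (i, a) (j, b) = (qfact q (i + j)%N)%:C * T (i + j)%N a b.
Proof. by []. Qed.

(* Ho-Kalman: the block shift maps each spanning column to a combination of
   spanning columns, and its matrix is A. *)
Lemma realization_of_finite_rank : finite_rank (qHankel q T) ->
  exists N (Cm : 'M[Cx R]_(n, N)) (A : 'M[Cx R]_N) (B : 'M[Cx R]_(N, m)),
    forall k, T k = ((qfact q k)^-1)%:C *: (Cm *m mxpow A k *m B).
Proof.
move=> /finite_dim_span_subfamily[N [c /choice[w HE]]].
(* Column [l] of [A] expresses the column one block to the right of [c l] in the spanning columns,
   [B] expresses block column 0, and [Cm] is block row 0 of the spanning columns. *)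
pose A : 'M[Cx R]_N := \matrix_(l', l) w ((c l).1.+1, (c l).2) l'.
pose B : 'M[Cx R]_(N, m) := \matrix_(l, b) w (0%N, b) l.
pose Cm : 'M[Cx R]_(n, N) := \matrix_(a, l) qHankel q T (0%N, a) (c l).
have shiftH i a k b : qHankel q T (i, a) (k.+1, b) = qHankel q T (i.+1, a) (k, b).
  by rewrite !qHankelE addnS addSn.
(* The row index [i] stays general in the induction, since moving one block column to the left moves
   one block row down. *)
have colE j b i a :
    qHankel q T (i, a) (j, b) = \sum_l (mxpow A j *m B) l b * qHankel q T (i, a) (c l).
  elim: j i => [|j IH] i.
    rewrite HE //; apply: eq_bigr => l _. by rewrite mul1mx mxE.
  rewrite shiftH IH mxpowS -mulmxA.
  have cE l : qHankel q T (i.+1, a) (c l) = \sum_l' A l' l * qHankel q T (i, a) (c l').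
    under eq_bigr do rewrite mxE.
    by rewrite -HE // shiftH; case: (c l).
  under eq_bigr do rewrite cE mulr_sumr.
  rewrite exchange_big /=; apply: eq_bigr => l' _; rewrite !mxE mulr_suml.
  apply: eq_bigr => l _; rewrite mulrA; congr (_ * _); rewrite mulrC.
  by rewrite !mxE.
exists N, Cm, A, B => k; apply/matrixP => a b; rewrite [RHS]mxE.
rewrite -[LHS](qfactVM k); congr (_ * _).
have := colE k b 0%N a; rewrite qHankelE add0n => ->.
rewrite -mulmxA mxE; apply: eq_bigr => l _; rewrite mulrC; congr (_ * _).
by rewrite mxE.
Qed.

(** The factorials cancel and the Hankel matrix factors as (C A^i)(A^j B), so the [N] columns of the
    observability matrix (C A^i)_i span. *)
Lemma finite_rank_of_realization N (Cm : 'M[Cx R]_(n, N)) (A : 'M[Cx R]_N)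
    (B : 'M[Cx R]_(N, m)) :
  (forall k, T k = ((qfact q k)^-1)%:C *: (Cm *m mxpow A k *m B)) ->
  finite_rank (qHankel q T).
Proof.
move=> TE; exists N, (fun l x => (Cm *m mxpow A x.1) x.2 l) => -[j b].
exists (fun l => (mxpow A j *m B) l b) => -[i a] _ /=.
rewrite qHankelE TE mxE qfactMV mxpowD !mulmxA -mulmxA mxE.
by apply: eq_bigr => l _; rewrite mulrC.
Qed.

End Qfact.

(** * Scalar power series on a disc *)

Section PowerSeries.
Local Open Scope classical_set_scope.
Context {R : realType}.
Local Notation C := (Cx R).
Implicit Types (a b : nat -> C) (r : R) (z : C).

Definition pser a z : C := limn (series (fun k => a k * z ^+ k)).

Definition conv_disc r a := forall z, `|z| < r%:C -> cvgn (series (fun k => a k * z ^+ k)).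

Lemma pser_lim a z l : series (fun k => a k * z ^+ k) @ \oo --> l -> pser a z = l.
Proof. by move=> h; apply: cvg_lim => //; exact: norm_hausdorff. Qed.

Lemma cvg_pser r a z : conv_disc r a -> `|z| < r%:C ->
  series (fun k => a k * z ^+ k) @ \oo --> pser a z.
Proof. by move=> cv zr; exact: (cv z zr). Qed.

Lemma seriesS_cvg (u : nat -> C) (l : C) :
  (fun k => series u k.+1) @ \oo --> l -> series u @ \oo --> l.
Proof. by rewrite -(cvg_shiftS (series u)). Qed.

Lemma cvg_seriesS (u : nat -> C) (l : C) :
  series u @ \oo --> l -> (fun k => series u k.+1) @ \oo --> l.
Proof. by rewrite -(cvg_shiftS (series u)). Qed.

Lemma cvg_pser0 a : series (fun k => a k * 0 ^+ k) @ \oo --> a 0%N.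
Proof.
(* The partial sums equal [a 0] only from index 1 on, hence the shift; the term of index 0 relies on
   0^0 = 1. *)
apply: seriesS_cvg; apply: cvg_near_cst; near=> n.
rewrite seriesEnat /= big_nat_recl // big1 ?addr0 ?mulr1 // => i _.
by rewrite exprS mul0r mulr0.
Unshelve. all: by end_near. Qed.

Lemma pser0 a : pser a 0 = a 0%N.
Proof. exact/pser_lim/cvg_pser0. Qed.

Lemma cvg_sum_fin {T : Type} {F : set_system T} {FF : Filter F} (I : finType) (P : pred I)
    (f : I -> T -> C) (l : I -> C) :
  (forall i, P i -> f i x @[x --> F] --> l i) ->
  \sum_(i | P i) f i x @[x --> F] --> \sum_(i | P i) l i.
Proof. by move=> h; apply: cvg_big => //; exact: add_continuous. Qed.

Lemma cvg_prod_fin {T : Type} {F : set_system T} {FF : Filter F} (I : finType) (P : pred I)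
    (f : I -> T -> C) (l : I -> C) :
  (forall i, P i -> f i x @[x --> F] --> l i) ->
  \prod_(i | P i) f i x @[x --> F] --> \prod_(i | P i) l i.
Proof. by move=> h; apply: cvg_big => //; exact: mul_continuous. Qed.

Lemma cvg_pser_lincomb p (c : 'I_p -> C) (b : 'I_p -> nat -> C) (s : 'I_p -> C) z :
  (forall l, series (fun k => b l k * z ^+ k) @ \oo --> s l) ->
  series (fun k => (\sum_l c l * b l k) * z ^+ k) @ \oo --> \sum_l c l * s l.
Proof.
move=> cb.
have -> : series (fun k => (\sum_l c l * b l k) * z ^+ k) =
    fun n => \sum_l c l * series (fun k => b l k * z ^+ k) n.
  apply/funext => n; under [RHS]eq_bigr do rewrite seriesEnat /= mulr_sumr.
  rewrite exchange_big seriesEnat /=; apply: eq_bigr => k _; rewrite mulr_suml.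
  by apply: eq_bigr => l _; rewrite mulrA.
by apply: cvg_sum_fin => l _; apply: cvgM => //; exact: cvg_cst.
Qed.

Lemma conv_disc_lincomb r p (c : 'I_p -> C) (b : 'I_p -> nat -> C) :
  (forall l, conv_disc r (b l)) -> conv_disc r (fun k => \sum_l c l * b l k).
Proof.
move=> cb z zr; apply/cvg_ex; exists (\sum_l c l * pser (b l) z).
by apply: cvg_pser_lincomb => l; exact: cvg_pser zr.
Qed.

Lemma pser_lincomb r p (c : 'I_p -> C) (b : 'I_p -> nat -> C) z :
  (forall l, conv_disc r (b l)) -> `|z| < r%:C ->
  pser (fun k => \sum_l c l * b l k) z = \sum_l c l * pser (b l) z.
Proof.
by move=> cb zr; apply/pser_lim/cvg_pser_lincomb => l; apply: cvg_pser (cb l) zr.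
Qed.

Lemma cvg_pser_shift a z l : z != 0 ->
  series (fun k => a k * z ^+ k) @ \oo --> l ->
  series (fun k => a k.+1 * z ^+ k) @ \oo --> (l - a 0%N) / z.
Proof.
move=> z0 cl.
have -> : series (fun k => a k.+1 * z ^+ k) =
    fun n => (series (fun k => a k * z ^+ k) n.+1 - a 0%N) * z^-1.
  apply/funext => n; rewrite !seriesEnat /= big_nat_recl //= mulr1 addrAC subrr add0r mulr_suml.
  by apply: eq_bigr => k _; rewrite exprSr mulrA mulfK.
apply: cvgM; last exact: cvg_cst.
by apply: cvgB; [exact: cvg_seriesS | exact: cvg_cst].
Qed.

Lemma conv_disc_shift r a : conv_disc r a -> conv_disc r (fun k => a k.+1).
Proof.
move=> ca z zr; apply/cvg_ex; have [->|z0] := eqVneq z 0.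
  by exists (a 1%N); exact: (cvg_pser0 (fun k => a k.+1)).
by exists ((pser a z - a 0%N) / z); apply: cvg_pser_shift => //; exact: cvg_pser zr.
Qed.

Lemma pser_shift r a z : z != 0 -> conv_disc r a -> `|z| < r%:C ->
  pser (fun k => a k.+1) z = (pser a z - a 0%N) / z.
Proof. by move=> z0 ca zr; apply/pser_lim/cvg_pser_shift => //; exact: cvg_pser ca zr. Qed.

(** Convergence at the single point [r / 2] forces the terms there to tend to 0, hence to be
    bounded. *)
Lemma conv_disc_bound r a : 0 < r -> conv_disc r a ->
  exists2 rho : R, 0 < rho < r & exists2 M : C, 0 < M & forall k, `|a k| * rho%:C ^+ k <= M.
Proof.
move=> r0 ca; exists (r / 2); first by rewrite divr_gt0 ?ltr_pdivrMr ?ltr_pMr ?ltr1n.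
have rho_gt0 : 0 < (r / 2)%:C :> C by rewrite ltcR divr_gt0.
have zr : `|(r / 2)%:C : C| < r%:C.
  by rewrite gtr0_norm // ltcR ltr_pdivrMr // ltr_pMr // ltr1n.
have cu := cvg_series_cvg_0 (ca _ zr).
have /cvg_seq_bounded /pinfty_ex_gt0[M M0 hM] := cvgP _ cu.
exists M => // k; have /= := hM k Logic.I.
by rewrite normrM normrX [`|(r / 2)%:C|]gtr0_norm.
Qed.

(** Past [a 0], every partial sum is dominated by M x (1 + x + x^2 + ...) with x = |z|/rho at most
    1/2, that is by 2 M x, uniformly in its length. *)
Lemma pser_continuous0 r a : 0 < r -> conv_disc r a -> pser a z @[z --> 0] --> a 0%N.
Proof.
move=> r0 ca; have [rho /andP[rho0 rhor] [M M0 aM]] := conv_disc_bound _ _ r0 ca.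
have rho0' : 0 < rho%:C :> C by rewrite ltcR.
apply/(@cvgrPdist_le C C C (nbhs (0 : C))) => eps eps0.
near=> z.
have zhalf : `|z| < rho%:C / 2.
  by near: z; apply: (@nbhs0_lt C C); rewrite divr_gt0.
(* Chosen so that [M * (x * 2)] is at most [eps / 2]. *)
have zeps : `|z| < eps / 2 * rho%:C / (2 * M).
  by near: z; apply: (@nbhs0_lt C C); rewrite !(divr_gt0, mulr_gt0).
have zr : `|z| < r%:C.
  by rewrite (lt_trans zhalf) // (@lt_trans _ _ rho%:C) ?ltcR // ltr_pdivrMr // ltr_pMr // ltr1n.
(* The index [n] depends on [z], which is harmless as the bound [tail] does not depend on [n].
   Taking [n.+1] terms lets [a 0] be split off. *)
have /cvgrPdist_lt/(_ (eps / 2)) := cvg_pser _ _ _ ca zr.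
rewrite divr_gt0 // => /(_ isT) -[n _ /(_ n.+1 (leqnSn _))] /= close.
set x := `|z| / rho%:C.
have x0 : 0 <= x by rewrite divr_ge0 // ltW.
have xhalf : x <= 2^-1 by rewrite ler_pdivrMr // mulrC ltW.
have geo : \sum_(0 <= k < n) x ^+ k <= 2.
  have h : (1 - x) * \sum_(0 <= k < n) x ^+ k <= 1.
    rewrite big_mkord -opprB mulNr -subrX1 opprB lerBlDr lerDl exprn_ge0 //.
  have s0 : 0 <= \sum_(0 <= k < n) x ^+ k by apply: sumr_ge0 => k _; rewrite exprn_ge0.
  have i2 : 0 < 2^-1 :> C by rewrite invr_gt0.
  rewrite -(ler_pM2l i2) mulVf ?pnatr_eq0 //.
  apply: le_trans h; apply: ler_wpM2r => //.
  by rewrite lerBrDr -lerBrDl (le_trans xhalf) // {2}(splitr 1) div1r addrK.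
have tail : `|a 0%N - series (fun k => a k * z ^+ k) n.+1| <= M * (x * 2).
  rewrite seriesEnat /= big_nat_recl //= mulr1 opprD addrA subrr add0r normrN.
  apply: (le_trans (ler_norm_sum _ _ _)).
  apply: (@le_trans _ _ (\sum_(0 <= k < n) M * (x * x ^+ k))).
    apply: ler_sum => k _; rewrite -exprS normrM normrX expr_div_n mulrA.
    rewrite ler_pdivlMr; last exact: exprn_gt0.
    by rewrite mulrAC; apply: ler_wpM2r (aM _); exact: exprn_ge0.
  rewrite -!mulr_sumr; apply: ler_wpM2l; first exact: ltW.
  exact: ler_wpM2l.
rewrite -(subrKA (series (fun k => a k * z ^+ k) n.+1)) (le_trans (ler_normD _ _)) //.
rewrite [leRHS]splitr lerD //; last by rewrite distrC ltW.
apply: (le_trans tail); rewrite mulrCA [M * 2]mulrC -ler_pdivlMr ?mulr_gt0 //.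
by rewrite ler_pdivrMr // mulrAC ltW.
Unshelve. all: by end_near. Qed.

(** * The operator R_q on power series *)

Section JacksonDerivative.
Variable q : R.
Hypotheses (q_ge0 : 0 <= q) (q_lt1 : q < 1).

(** The action of R_q on Taylor coefficients; for q = 0 it is the plain left shift, as [k+1]_0 =
    1. *)
Definition qshift a (k : nat) : C := (qint q k.+1)%:C * a k.+1.

Lemma normMq z : `|q%:C * z| <= `|z|.
Proof.
rewrite normrM ler_piMl // ger0_norm ?ler0c //.
by have := lecR q 1; rewrite rmorph1 => ->; exact: ltW.
Qed.

Lemma qint_geom k : (1 - q) * qint q k = 1 - q ^+ k.
Proof. by rewrite /qint -opprB mulNr -subrX1 opprB. Qed.

(** The constant terms cancel in the difference, and 1 - q^(k+1) = (1 - q) [k+1]_q gives the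
    remaining ones. *)
Lemma cvg_pser_qshift a z l l' : z != 0 ->
  series (fun k => a k * z ^+ k) @ \oo --> l ->
  series (fun k => a k * (q%:C * z) ^+ k) @ \oo --> l' ->
  series (fun k => qshift a k * z ^+ k) @ \oo --> (l - l') / ((1 - q)%:C * z).
Proof.
move=> z0 cl cl'.
have q10 : (1 - q)%:C != 0 :> C by rewrite fmorph_eq0 subr_eq0 gt_eqF.
have -> : series (fun k => qshift a k * z ^+ k) =
    fun n => (series (fun k => a k * z ^+ k) n.+1 -
              series (fun k => a k * (q%:C * z) ^+ k) n.+1) * ((1 - q)%:C * z)^-1.
  apply/funext => n; rewrite !seriesEnat /= -sumrB big_nat_recl //= subrr add0r mulr_suml.
  apply: eq_bigr => k _; apply: (canRL (mulfK _)); first by rewrite mulf_neq0.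
  transitivity ((1 - q)%:C * (qint q k.+1)%:C * (a k.+1 * z ^+ k.+1)).
    rewrite /qshift exprSr -!mulrA [in LHS](mulrCA (z ^+ k)).
    by rewrite [in LHS](mulrCA (a k.+1)) [LHS]mulrCA.
  by rewrite -rmorphM qint_geom rmorphB rmorph1 rmorphXn mulrBl mul1r exprMn mulrCA.
apply: cvgM; last exact: cvg_cst.
exact: cvgB (cvg_seriesS _ _ cl) (cvg_seriesS _ _ cl').
Qed.

Lemma conv_disc_qshift r a : conv_disc r a -> conv_disc r (qshift a).
Proof.
move=> ca z zr; apply/cvg_ex; have [->|z0] := eqVneq z 0.
  by exists (qshift a 0%N); exact: cvg_pser0.
exists ((pser a z - pser a (q%:C * z)) / ((1 - q)%:C * z)).
apply: cvg_pser_qshift => //; first exact: cvg_pser zr.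
by apply: (cvg_pser r) => //; exact: le_lt_trans (normMq z) zr.
Qed.

(** Written without division so that z = 0 is covered; this is the form used for the functional
    equation of E. *)
Lemma pser_qdiff r a z : conv_disc r a -> `|z| < r%:C ->
  pser a z - pser a (q%:C * z) = (1 - q)%:C * z * pser (qshift a) z.
Proof.
move=> ca zr; have [->|z0] := eqVneq z 0; first by rewrite !mulr0 mul0r subrr.
have q10 : (1 - q)%:C != 0 :> C by rewrite fmorph_eq0 subr_eq0 gt_eqF.
rewrite (pser_lim _ _ _ (cvg_pser_qshift _ _ _ _ z0 (cvg_pser _ _ _ ca zr)
  (cvg_pser _ _ _ ca (le_lt_trans (normMq z) zr)))).
by rewrite [RHS]mulrC divfK // mulf_neq0.
Qed.

Lemma Rq_pser r a (f : C -> C) : 0 < r -> conv_disc r a ->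
  (forall z, `|z| < r%:C -> f z = pser a z) ->
  forall z, `|z| < r%:C -> Rq q f z = pser (qshift a) z.
Proof.
move=> r0 ca fE z zr; rewrite /Rq; case: eqVneq => [z0|z0].
  have q1 : qint q 1 = 1 by rewrite /qint big_ord1 expr0.
  rewrite z0 pser0 /qshift q1 rmorph1 mul1r.
  apply: cvg_lim; first exact: norm_hausdorff.
  (* At the origin the difference quotient of [f] is the shifted series, whose continuity at 0 gives
     the derivative [a 1]; this is [qshift q a 0], because [1]_q = 1. *)
  have cshift : (pser (fun k => a k.+1) h : C) @[h --> (0 : C)^'] --> a 1%N.
    apply: cvg_within_filter.
    exact: (pser_continuous0 r (fun k => a k.+1) r0 (conv_disc_shift _ _ ca)).
  apply: cvg_trans cshift; apply: near_eq_cvg; near=> h.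
  have h0 : h != 0 by near: h; exact: nbhs_dnbhs_neq.
  have hr : `|h| < r%:C by near: h; apply: (@dnbhs0_lt C C); rewrite ltcR.
  rewrite /= addr0 [h *: _]mulr1 (fE h) // (fE 0) ?normr0 ?ltcR // pser0.
  by rewrite (pser_shift r) // mulrC.
have zr' : `|q%:C * z| < r%:C by exact: le_lt_trans (normMq z) zr.
have q10 : (1 - q)%:C != 0 :> C by rewrite fmorph_eq0 subr_eq0 gt_eqF.
rewrite !fE // (pser_qdiff r) //.
by rewrite [LHS]mulrC mulKf // mulf_neq0.
Unshelve. all: by end_near. Qed.

Lemma conv_disc_iter_qshift r a k : conv_disc r a -> conv_disc r (iter k qshift a).
Proof. by move=> ca; elim: k => [|k IH]; [exact: ca | exact: conv_disc_qshift IH]. Qed.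

Lemma iter_Rq_pser r a (f : C -> C) k : 0 < r -> conv_disc r a ->
  (forall z, `|z| < r%:C -> f z = pser a z) ->
  forall z, `|z| < r%:C -> iter k (Rq q) f z = pser (iter k qshift a) z.
Proof.
move=> r0 ca fE; elim: k => [|k IH] z zr; first exact: fE.
exact: Rq_pser r0 (conv_disc_iter_qshift _ _ k ca) IH z zr.
Qed.

(** The factors [j+1]_q, ..., [j+k]_q collected by the iterates turn [j]_q! into [j+k]_q!, the
    weight of a Hankel entry. *)
Lemma qfact_iter_qshift a k j :
  (qfact q j)%:C * iter k qshift a j = (qfact q (j + k)%N)%:C * a (j + k)%N.
Proof.
elim: k j => [|k IH] j; first by rewrite addn0.
by rewrite iterS {1}/qshift mulrA -rmorphM -qfactS IH addSnnS.
Qed.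

(* The coefficients are read off at 0 as a_k = (R_q^k f)(0) / [k]_q!. *)
Lemma pser_inj r a b : 0 < r -> conv_disc r a -> conv_disc r b ->
  (forall z, `|z| < r%:C -> pser a z = pser b z) -> a = b.
Proof.
move=> r0 ca cb ab; apply/funext => k.
have z0r : `|0 : C| < r%:C by rewrite normr0 ltcR.
have := iter_Rq_pser _ _ (pser a) k r0 ca (fun _ _ => erefl) 0 z0r.
rewrite (iter_Rq_pser _ _ _ k r0 cb ab 0 z0r) !pser0.
(* The factor [0]_q! = 1 brings both sides to the form of [qfact_iter_qshift] with j = 0. *)
move/(congr1 (fun x => (qfact q 0)%:C * x)); rewrite !qfact_iter_qshift add0n.
by move/(mulfI (qfact_neq0 _ _ q_ge0 k)).
Qed.

End JacksonDerivative.

End PowerSeries.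

(** * Limits of complex sequences and matrices *)

Section ComplexLimits.
Local Open Scope classical_set_scope.
Context {R : realType}.
Local Notation C := (Cx R).

(** Complex numbers are comparable only when their imaginary parts agree, so a positive one is real;
    this turns a complex epsilon or radius into a real one. *)
Lemma gt0_real_complex (e : C) : 0 < e -> exists2 x : R, 0 < x & e = x%:C.
Proof.
move=> e0; have eE : (complex.Re e)%:C = e by apply: RRe_real; exact: gtr0_real.
by exists (complex.Re e); rewrite -?ltcR eE.
Qed.

Lemma cvg_real_complex (u : nat -> R) (l : R) :
  u @ \oo --> l -> ((u k)%:C : C) @[k --> \oo] --> (l%:C : C).
Proof.
move=> /cvgrPdist_lt ul; apply/cvgrPdist_lt => eps /gt0_real_complex[e e0 ->].
have := ul _ e0; apply: filterS => k.
by rewrite -rmorphB /= normc_def /= expr0n /= addr0 sqrtr_sqr ltcR.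
Qed.

Lemma normc_ge_Im (x : C) : (`|complex.Im x|%:C : C) <= `|x|.
Proof. by rewrite normc_def /= lecR -sqrtr_sqr ler_wsqrtr // lerDr sqr_ge0. Qed.

(** The real and imaginary parts are each dominated by the geometric series of ratio 1/2, so both
    converge absolutely. *)
Lemma geometric_cvg_series (u : nat -> C) :
  (forall k, `|u k| <= (2^-1 ^+ k)%:C) -> cvgn (series u).
Proof.
move=> ub.
have cvR (v : nat -> R) : (forall k, `|v k| <= 2^-1 ^+ k) -> cvgn (series v).
  move=> vb; apply: normed_cvg; apply: (@series_le_cvg _ _ (geometric 1 2^-1)).
  - by move=> k; exact: normr_ge0.
  - by move=> k; rewrite /= mul1r exprn_ge0.
  - by move=> k; rewrite /= mul1r.
  - by apply: is_cvg_geometric_series; rewrite gtr0_norm ?invr_gt0 // invf_lt1 // ltr1n.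
have /cvR/cvg_ex[lr cr] : forall k, `|complex.Re (u k)| <= 2^-1 ^+ k.
  by move=> k; rewrite -lecR; apply: le_trans (ub k); exact: normc_ge_Re.
have /cvR/cvg_ex[li ci] : forall k, `|complex.Im (u k)| <= 2^-1 ^+ k.
  by move=> k; rewrite -lecR; apply: le_trans (ub k); exact: normc_ge_Im.
apply/cvg_ex; exists (lr%:C + 'i%C * li%:C : C).
have -> : series u = fun n => (series (fun k => complex.Re (u k)) n)%:C +
    'i%C * (series (fun k => complex.Im (u k)) n)%:C :> C.
  apply/funext => n; rewrite !seriesEnat /= !rmorph_sum mulr_sumr -big_split /=.
  by apply: eq_bigr => k _; exact: complexE.
apply: cvgD; first exact: cvg_real_complex cr.
by apply: cvgM; [exact: cvg_cst | exact: cvg_real_complex ci].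
Qed.

Section MatrixLimits.
Context {T : Type} {F : set_system T} {FF : Filter F}.

Lemma cvg_mulmx n p m (f : T -> 'M[C]_(n, p)) (g : T -> 'M[C]_(p, m))
    (A : 'M[C]_(n, p)) (B : 'M[C]_(p, m)) :
  (forall i j, f x i j @[x --> F] --> A i j) ->
  (forall i j, g x i j @[x --> F] --> B i j) ->
  forall i j, (f x *m g x) i j @[x --> F] --> (A *m B) i j.
Proof.
move=> fA gB i j; rewrite mxE.
under eq_cvg do rewrite mxE.
by apply: cvg_sum_fin => l _; apply: cvgM.
Qed.

Lemma cvg_det n (f : T -> 'M[C]_n) (A : 'M[C]_n) :
  (forall i j, f x i j @[x --> F] --> A i j) -> \det (f x) @[x --> F] --> \det A.
Proof.
move=> fA; apply: cvg_sum_fin => s _; apply: cvgM; first exact: cvg_cst.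
exact: cvg_prod_fin.
Qed.

(** Cramer's rule: each entry of the inverse is a signed minor divided by the determinant, both
    polynomial in the entries. Invertibility of every [f x] gives this formula for all x. *)
Lemma cvg_invmx n (f : T -> 'M[C]_n) (A : 'M[C]_n) : A \in unitmx -> (forall x, f x \in unitmx) ->
  (forall i j, f x i j @[x --> F] --> A i j) ->
  forall i j, invmx (f x) i j @[x --> F] --> invmx A i j.
Proof.
move=> uA uf fA i j.
have invE (M : 'M[C]_n) : M \in unitmx ->
    invmx M i j = (\det M)^-1 * ((-1) ^+ (j + i)%N * \det (row' j (col' i M))).
  by move=> uM; rewrite /invmx uM !mxE.
rewrite (invE A) // (_ : (fun x => invmx (f x) i j) = fun x => (\det (f x))^-1 *
    ((-1) ^+ (j + i)%N * \det (row' j (col' i (f x))))); last first.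
  by apply/funext => x; exact: invE.
apply: cvgM.
  by apply: cvgV; [rewrite -unitfE -unitmxE | exact: cvg_det].
apply: cvgM; first exact: cvg_cst.
apply: cvg_det => i' j'; rewrite !mxE.
rewrite (_ : (fun x => _) = fun x => f x (lift j i') (lift i j')); first exact: fA.
by apply/funext => x; rewrite !mxE.
Qed.

End MatrixLimits.
End ComplexLimits.

(** * The matrix q-exponential and the infinite product *)

Section QExponential.
Local Open Scope classical_set_scope.
Context {R : realType} (q : R) (N : nat) (A : 'M[Cx R]_N).
Hypotheses (q_ge0 : 0 <= q) (q_lt1 : q < 1).
Local Notation C := (Cx R).

Definition qexp_coef (k : nat) : 'M[C]_N := ((qfact q k)^-1)%:C *: mxpow A k.

Local Notation E := (pseries_val qexp_coef).

Lemma mxpow_bound : exists2 K : R, 0 < K & forall k i j, `|mxpow A k i j| <= (K ^+ k)%:C.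
Proof.
(* This constant dominates every absolute row sum of [A], which drives the induction on [k]; the
   summand 1 keeps it positive even if [A] is zero or empty. *)
have K0 : 0 < 1 + \sum_i \sum_j `|A i j|.
  by rewrite ltr_pwDl // sumr_ge0 // => i _; rewrite sumr_ge0.
have [K Kpos KE] := gt0_real_complex _ K0.
exists K => //; elim=> [|k IH] i j.
  by rewrite /mxpow /= mxE expr0; case: eqP; rewrite ?normr1 ?normr0 ?ler0c ?ler01.
rewrite mxpowS mxE (le_trans (ler_norm_sum _ _ _)) //.
apply: (@le_trans _ _ (\sum_l `|A i l| * (K ^+ k)%:C)).
  by apply: ler_sum => l _; rewrite normrM ler_wpM2l.
rewrite -mulr_suml exprS rmorphM ler_wpM2r ?ler0c ?exprn_ge0 ?(ltW Kpos) //.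
rewrite /= -KE [X in _ <= 1 + X](bigD1 i) //= addrCA lerDl addr_ge0 //.
by rewrite sumr_ge0 // => l _; rewrite sumr_ge0.
Qed.

Lemma qexp_conv : exists2 r : R, 0 < r &
  forall i j, conv_disc r (fun k => qexp_coef k i j).
Proof.
have [K K0 bK] := mxpow_bound.
(* As [k]_q! is at least 1, the k-th term is at most (K |z|)^k, hence at most 2^-k on this disc. *)
exists (2^-1 / K); first by rewrite divr_gt0 ?invr_gt0.
move=> i j z zr; apply: geometric_cvg_series => k.
rewrite mxE !normrM normrX.
have -> : `|((qfact q k)^-1)%:C : C| = ((qfact q k)^-1)%:C.
  by rewrite ger0_norm // ler0c invr_ge0 (le_trans ler01) // qfact_ge1.
have le1 : ((qfact q k)^-1)%:C <= 1 :> C.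
  rewrite -[1](rmorph1 (real_complex R)) lecR invf_le1 ?qfact_ge1 //.
  by rewrite (lt_le_trans ltr01) // qfact_ge1.
apply: (@le_trans _ _ ((K ^+ k)%:C * `|z| ^+ k)).
  rewrite ler_wpM2r ?exprn_ge0 //; apply: le_trans (bK k i j).
  by rewrite ler_piMl.
have K0' : 0 <= K%:C :> C by rewrite ler0c ltW.
have Kz : K%:C * `|z| <= (2^-1)%:C.
  apply: (le_trans (ler_wpM2l K0' (ltW zr))).
  by rewrite -rmorphM lecR mulrC divfK // gt_eqF.
rewrite !rmorphXn -exprMn; apply: lerXn2r Kz; rewrite nnegrE.
  exact: mulr_ge0.
by rewrite ler0c invr_ge0.
Qed.

Lemma qexpE z i j : E z i j = pser (fun k => qexp_coef k i j) z.
Proof. by rewrite mxE. Qed.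

Lemma qexp_continuous0 i j : E z i j @[z --> (0 : C)] --> (1%:M : 'M[C]_N) i j.
Proof.
have [r r0 cr] := qexp_conv.
under eq_cvg do rewrite qexpE.
have := pser_continuous0 r _ r0 (cr i j).
by rewrite /qexp_coef /qfact big_ord0 invr1 rmorph1 scale1r.
Qed.

(** Since [k+1]_q / [k+1]_q! = 1 / [k]_q!, applying R_q to E multiplies it by [A] on the left;
    [pser_qdiff] turns this into the stated equation. *)
Lemma qexp_functional r z : (forall i j, conv_disc r (fun k => qexp_coef k i j)) ->
  `|z| < r%:C -> E (q%:C * z) = qfactor q A z 0 *m E z.
Proof.
move=> cr zr; apply/matrixP => i j.
rewrite /qfactor mulmxBl mul1mx expr0 mulr1 -scalemxAl.
rewrite [RHS]mxE [X in _ + X]mxE [X in _ - X]mxE [X in _ - _ * X]mxE.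
apply/eqP; rewrite eq_sym subr_eq addrC -subr_eq; apply/eqP.
move: (q%:C * z) (pser_qdiff q q_ge0 q_lt1 r _ _ (cr i j) zr) => w qd.
transitivity (pser (fun k => qexp_coef k i j) z - pser (fun k => qexp_coef k i j) w).
  by congr (_ - _); exact: qexpE.
rewrite qd; congr (_ * _).
under eq_bigr do rewrite qexpE.
rewrite -(pser_lincomb r) //; congr (pser _ z); apply/funext => k.
rewrite /qshift mxE mxpowS mulrA -rmorphM qfactS invfM mulrCA mulfV ?mulr1; last first.
  by rewrite gt_eqF // (lt_le_trans ltr01) // qintS_ge1.
rewrite mxE mulr_sumr; apply: eq_bigr => l _.
by rewrite [in RHS]mxE mulrCA.
Qed.

(** By continuity det E(z) tends to det I = 1 at the origin, so it stays within distance less than 1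
    of 1 and cannot vanish. *)
Lemma qexp_unit_disc : exists2 r : R, 0 < r &
  (forall i j, conv_disc r (fun k => qexp_coef k i j)) /\
  (forall z, `|z| < r%:C -> E z \in unitmx).
Proof.
have [r r0 cr] := qexp_conv.
have /cvgrPdist_lt/(_ 1 ltr01) : \det (E z) @[z --> (0 : C)] --> \det (1%:M : 'M[C]_N).
  by apply: (@cvg_det R C (nbhs (0 : C)) _ N) => i j; exact: qexp_continuous0.
rewrite det1 => /nbhs_ballP[e /= /gt0_real_complex[x x0 ->] eP].
have mr : Num.min r x <= r by rewrite ge_min lexx.
have mx : Num.min r x <= x by rewrite ge_min lexx orbT.
exists (Num.min r x); first by rewrite lt_min r0.
split=> [i j z zr|z zx]; first by apply: cr; rewrite (lt_le_trans zr) // lecR.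
rewrite unitmxE unitfE; apply/negP => /eqP d0.
have /eP : ball (0 : C) (x%:C : C) z.
  by rewrite -ball_normE /= sub0r normrN (lt_le_trans zx) // lecR.
by rewrite /= d0 subr0 normr1 ltxx.
Qed.

Lemma qfactorS z j : qfactor q A z j.+1 = qfactor q A (q%:C * z) j.
Proof.
rewrite /qfactor; congr (_ - _ *: _).
by rewrite [RHS]mulrA -rmorphM -mulrA -exprSr.
Qed.

Lemma qprod_partialS z J :
  qprod_partial q A z J.+1 = invmx (qfactor q A z 0) *m qprod_partial q A (q%:C * z) J.
Proof.
rewrite /qprod_partial big_ord_recl; congr (_ *m _).
by apply: eq_bigr => j _; rewrite -qfactorS.
Qed.

Lemma normMqX j (z : C) : `|q%:C ^+ j * z| <= `|z|.
Proof.
elim: j => [|j IH]; first by rewrite mul1r.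
by rewrite exprS -mulrA (le_trans (normMq _ _ _ _)).
Qed.

(* Iterating E (q z) = (1 - (1 - q) z A) E z gives
   P_J(z) = E z * (E (q^J z))^-1, and E (q^J z) tends to E 0 = 1. *)
Lemma cvg_qprod : exists2 r : R, 0 < r &
  (forall i j, conv_disc r (fun k => qexp_coef k i j)) /\
  forall z, `|z| < r%:C ->
    (forall j, qfactor q A z j \in unitmx) /\
    forall i j, qprod_partial q A z J i j @[J --> \oo] --> E z i j.
Proof.
have [r r0 [cr uE]] := qexp_unit_disc; exists r => //; split=> //.
(* The factor is the left member of a product equal to the invertible matrix E(qz). *)
have uF0 z : `|z| < r%:C -> qfactor q A z 0 \in unitmx.
  move=> zr; have := uE _ (le_lt_trans (normMq q q_ge0 q_lt1 z) zr).
  by rewrite (qexp_functional r z cr zr) unitmx_mul => /andP[].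
have uF j z : `|z| < r%:C -> qfactor q A z j \in unitmx.
  elim: j z => [|j IH] z zr; first exact: uF0.
  by rewrite qfactorS IH // (le_lt_trans (normMq q q_ge0 q_lt1 z)).
move=> z zr; split=> [j|i j]; first exact: uF.
(* The point [w] is general because peeling off the first factor replaces [w] by [q w]. *)
have PE J w : `|w| < r%:C -> qprod_partial q A w J *m E (q%:C ^+ J * w) = E w.
  elim: J w => [|J IH] w wr; first by rewrite /qprod_partial big_ord0 mul1mx mul1r.
  rewrite qprod_partialS exprSr -!mulmxA -mulrA IH; last first.
    exact: le_lt_trans (normMq q q_ge0 q_lt1 w) wr.
  by rewrite (qexp_functional r w cr wr) mulKmx // uF0.
have uEJ J : E (q%:C ^+ J * z) \in unitmx by rewrite uE // (le_lt_trans (normMqX _ _)).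
have -> : (fun J => qprod_partial q A z J i j) =
    fun J => (E z *m invmx (E (q%:C ^+ J * z))) i j.
  by apply/funext => J; rewrite -{1}(PE J z zr) mulmxK.
have -> : E z i j = (E z *m invmx 1%:M) i j by rewrite invmx1 mulmx1.
apply: cvg_mulmx => [i' j'|]; first exact: cvg_cst.
apply: cvg_invmx => // [|i' j']; first exact: unitmx1.
have qJ : (q%:C ^+ J * z : C) @[J --> \oo] --> (0 : C).
  rewrite -(mul0r z); apply: cvgM; last exact: cvg_cst.
  have /cvg_real_complex : (GRing.exp q : nat -> R) @ \oo --> (0 : R).
    by apply: cvg_expr; rewrite ger0_norm.
  by rewrite rmorph0; under eq_cvg do rewrite rmorphXn.
exact: cvg_comp qJ (qexp_continuous0 i' j').
Qed.

End QExponential.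

(** * Hankel columns versus columns of R_q^k T *)

Section Hankel.
Context {R : realType} (q : R) (n m : nat) (T : nat -> 'M[Cx R]_(n, m)) (r0 : R).
Hypotheses (q_ge0 : 0 <= q) (q_lt1 : q < 1) (r0_gt0 : 0 < r0).
Hypothesis convT : forall z : Cx R, `|z| < r0%:C -> pseries_conv T z.
Local Notation C := (Cx R).

Let t a b (k : nat) : C := T k a b.

Let conv_t a b : conv_disc r0 (t a b).
Proof. by move=> z zr; exact: convT. Qed.

Lemma iter_RqM (F : C -> 'M[C]_(n, m)) k z a b :
  iter k (@RqM R q n m) F z a b = iter k (Rq q) (fun w => F w a b) z.
Proof.
elim: k z => [//|k IH] z; rewrite !iterS {1}/RqM mxE.
by congr (Rq q _ z); apply/funext => w; exact: IH.
Qed.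

Lemma iter_RqM_pser k z a b : `|z| < r0%:C ->
  iter k (@RqM R q n m) (pseries_val T) z a b = pser (iter k (qshift q) (t a b)) z.
Proof.
move=> zr; rewrite iter_RqM.
apply: (iter_Rq_pser q q_ge0 q_lt1 r0 (t a b) _ k r0_gt0 (conv_t a b)) zr.
by move=> w _; rewrite mxE.
Qed.

Lemma qHankel_iter_qshift j a k b :
  qHankel q T (j, a) (k, b) = (qfact q j)%:C * iter k (qshift q) (t a b) j.
Proof. by rewrite qfact_iter_qshift. Qed.

(** Entry (j, a) of a Hankel column is [j]_q! times the j-th Taylor coefficient of component a of
    the corresponding function. Summing the series gives one direction, uniqueness of coefficients
    the other, with the same weights [w]. *)
Lemma Hankel_RqM_relation p (c : 'I_p -> nat * 'I_m) (w : 'I_p -> C) k b :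
  (forall x : nat * 'I_n, True -> qHankel q T x (k, b) = \sum_l w l * qHankel q T x (c l)) <->
  (forall x : C * 'I_n, `|x.1| < r0%:C ->
     iter k (@RqM R q n m) (pseries_val T) x.1 x.2 b =
     \sum_l w l * iter (c l).1 (@RqM R q n m) (pseries_val T) x.1 x.2 (c l).2).
Proof.
pose s a l := iter (c l).1 (qshift q) (t a (c l).2).
have conv_s a l : conv_disc r0 (s a l).
  exact: conv_disc_iter_qshift q q_ge0 q_lt1 _ _ _ (conv_t a (c l).2).
have HE j a l : qHankel q T (j, a) (c l) = (qfact q j)%:C * s a l j.
  by rewrite /s -qHankel_iter_qshift; case: (c l).
split=> [Hw [z a] /= zr | fw [j a] _].
  rewrite iter_RqM_pser //; under eq_bigr do rewrite iter_RqM_pser //.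
  rewrite -(pser_lincomb r0 p w (s a) z (conv_s a) zr); congr (pser _ z).
  apply/funext => j; apply: (mulfI (qfact_neq0 _ _ q_ge0 j)).
  rewrite -qHankel_iter_qshift Hw // mulr_sumr.
  by apply: eq_bigr => l _; rewrite HE mulrCA.
have /(congr1 (fun u => u j)) coefE :
    iter k (qshift q) (t a b) = fun j => \sum_l w l * s a l j.
  apply: (pser_inj q q_ge0 q_lt1 r0 _ _ r0_gt0).
  - exact: conv_disc_iter_qshift q q_ge0 q_lt1 _ _ _ (conv_t a b).
  - exact: conv_disc_lincomb.
  move=> z zr; rewrite (pser_lincomb r0 p w (s a) z (conv_s a) zr).
  have := fw (z, a) zr; rewrite /= iter_RqM_pser // => ->.
  by apply: eq_bigr => l _; rewrite iter_RqM_pser.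
rewrite qHankel_iter_qshift coefE mulr_sumr.
by apply: eq_bigr => l _; rewrite HE mulrCA.
Qed.

Lemma finite_rank_RqM : finite_rank (qHankel q T) <->
  finite_dim_span (fun x : C * 'I_n => `|x.1| < r0%:C)
     (fun (kj : nat * 'I_m) (x : C * 'I_n) =>
        iter kj.1 (@RqM R q n m) (pseries_val T) x.1 x.2 kj.2).
Proof.
(* Spanning vectors taken from the family itself have counterparts with the same indices on the
   other side, unlike arbitrary ones. *)
split=> /finite_dim_span_subfamily[p [c spanc]].
  exists p, (fun l x => iter (c l).1 (@RqM R q n m) (pseries_val T) x.1 x.2 (c l).2).
  move=> [k b]; have [w wE] := spanc (k, b); exists w.
  exact/Hankel_RqM_relation.
exists p, (fun l x => qHankel q T x (c l)) => -[k b].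
have [w wE] := spanc (k, b); exists w.
exact/Hankel_RqM_relation.
Qed.

(** * Product realizations versus Taylor coefficients *)

Section Realization.
Variables (N : nat) (Cm : 'M[C]_(n, N)) (A : 'M[C]_N) (B : 'M[C]_(N, m)).

Let S k : 'M[C]_(n, m) := ((qfact q k)^-1)%:C *: (Cm *m mxpow A k *m B).

Let S_coef a b k :
  S k a b = \sum_l B l b * \sum_l' Cm a l' * qexp_coef q N A k l' l.
Proof.
rewrite /S scalemxAl scalemxAr mxE; apply: eq_bigr => l _.
by rewrite mulrC; congr (_ * _); rewrite mxE.
Qed.

Let S_conv r : (forall i j, conv_disc r (fun k => qexp_coef q N A k i j)) ->
  forall a b, conv_disc r (fun k => S k a b).
Proof.
move=> cr a b; rewrite (funext (S_coef a b)).
by apply: conv_disc_lincomb => l; apply: conv_disc_lincomb => l'; exact: cr.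
Qed.

Let S_pser r z : (forall i j, conv_disc r (fun k => qexp_coef q N A k i j)) ->
  `|z| < r%:C -> forall a b, pser (fun k => S k a b) z =
    (Cm *m pseries_val (qexp_coef q N A) z *m B) a b.
Proof.
move=> cr zr a b; rewrite (funext (S_coef a b)).
rewrite (pser_lincomb r _ _ _ _ _ zr); last first.
  by move=> l; apply: conv_disc_lincomb => l'; exact: cr.
rewrite mxE; apply: eq_bigr => l _; rewrite mulrC; congr (_ * _).
rewrite (pser_lincomb r _ _ _ _ _ zr); last by move=> l'; exact: cr.
by rewrite mxE; apply: eq_bigr => l' _; rewrite qexpE.
Qed.

(** The hypothesis gives T = C E B near the origin, and [cvg_qprod] replaces E by the product
    there. *)
Lemma qprod_of_coef : (forall k, T k = S k) ->
  exists r : R, 0 < r /\ r <= r0 /\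
    forall z : C, `|z| < r%:C ->
      (forall j, qfactor q A z j \in unitmx) /\
      qprod_conv q A z /\
      pseries_val T z = Cm *m qprod_val q A z *m B.
Proof.
move=> TS; have [r r_gt0 [cr rP]] := cvg_qprod q N A q_ge0 q_lt1.
exists (Num.min r r0); rewrite lt_min r_gt0 r0_gt0 ge_min lexx orbT; split=> //; split=> // z zm.
have zr : `|z| < r%:C by rewrite (lt_le_trans zm) // lecR ge_min lexx.
have [uz cz] := rP z zr; split; first exact: uz.
split=> [i j|].
  by apply/cvg_ex; exists (pseries_val (qexp_coef q N A) z i j); exact: cz.
have -> : qprod_val q A z = pseries_val (qexp_coef q N A) z.
  apply/matrixP => i j; rewrite mxE; apply: cvg_lim (cz i j).
  exact: norm_hausdorff.
apply/matrixP => a b; rewrite -(S_pser r) // mxE.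
by congr (pser _ z); apply/funext => k; rewrite TS.
Qed.

(** On the smaller of the two discs the product equals E, so T and the series with coefficients [S]
    have the same sum; [pser_inj] then compares coefficients. *)
Lemma coef_of_qprod (r : R) : 0 < r -> r <= r0 ->
  (forall z : C, `|z| < r%:C -> pseries_val T z = Cm *m qprod_val q A z *m B) ->
  forall k, T k = S k.
Proof.
move=> r_gt0 rr0 TE; have [r' r'_gt0 [cr rP]] := cvg_qprod q N A q_ge0 q_lt1.
have [mr mr'] : Num.min r r' <= r /\ Num.min r r' <= r' by rewrite !ge_min !lexx orbT.
move=> k; apply/matrixP => a b.
suff /(congr1 (fun u => u k)) : t a b = fun k => S k a b by [].
apply: (pser_inj q q_ge0 q_lt1 (Num.min r r')); first by rewrite lt_min r_gt0.
- by move=> z zm; apply: conv_t; rewrite (lt_le_trans zm) // lecR (le_trans mr).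
- by move=> z zm; apply: (S_conv r') => //; rewrite (lt_le_trans zm) // lecR.
move=> z zm.
have zr : `|z| < r%:C by rewrite (lt_le_trans zm) // lecR.
have zr' : `|z| < r'%:C by rewrite (lt_le_trans zm) // lecR.
rewrite (S_pser r') //.
have -> : pseries_val (qexp_coef q N A) z = qprod_val q A z.
  apply/matrixP => i j; rewrite [RHS]mxE; apply/esym; apply: cvg_lim ((rP z zr').2 i j).
  exact: norm_hausdorff.
by rewrite -TE // mxE.
Qed.

End Realization.
End Hankel.

Theorem theorem5p8 (R : realType) (n m : nat) (q : R)
  (T : nat -> 'M[Cx R]_(n, m)) (r0 : R) :
  0 <= q -> q < 1 -> 0 < r0 ->
  (forall z : Cx R, `|z| < r0%:C -> pseries_conv T z) ->
  [<->
   (* (1) realization as an infinite q-product near the origin *)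
   (exists (N : nat) (Cm : 'M[Cx R]_(n, N)) (A : 'M[Cx R]_N)
           (B : 'M[Cx R]_(N, m)) (r : R),
      0 < r /\ r <= r0 /\
      forall z : Cx R, `|z| < r%:C ->
        (forall j, qfactor q A z j \in unitmx) /\
        qprod_conv q A z /\
        pseries_val T z = Cm *m qprod_val q A z *m B);
   (* (2) the block Hankel matrix has finite rank *)
   finite_rank (qHankel q T);
   (* (3) T_k = C A^k B / [k]_q! *)
   (exists (N : nat) (Cm : 'M[Cx R]_(n, N)) (A : 'M[Cx R]_N)
           (B : 'M[Cx R]_(N, m)),
      forall k, T k = ((qfact q k)^-1)%:C *: (Cm *m mxpow A k *m B));
   (* (4) span of the columns of R_q^k T (k >= 0), as functions on the
          disc of convergence, is finite dimensional *)
   finite_dim_span (fun x : Cx R * 'I_n => `|x.1| < r0%:C)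
     (fun (kj : nat * 'I_m) (x : Cx R * 'I_n) =>
        iter kj.1 (@RqM R q n m) (pseries_val T) x.1 x.2 kj.2)].
Proof.
move=> q_ge0 q_lt1 r0_gt0 convT.
have rank_of_coef : (exists (N : nat) (Cm : 'M[Cx R]_(n, N)) (A : 'M[Cx R]_N)
           (B : 'M[Cx R]_(N, m)),
      forall k, T k = ((qfact q k)^-1)%:C *: (Cm *m mxpow A k *m B)) ->
    finite_rank (qHankel q T).
  by move=> [N [Cm [A [B TE]]]]; exact: finite_rank_of_realization TE.
have coef_of_rank := realization_of_finite_rank R q q_ge0 n m T.
have rankP := finite_rank_RqM q n m T r0 q_ge0 q_lt1 r0_gt0 convT.
(* The cycle is (1) to (2) to (3) to (4) to (1): the first implication passes through (3), the last
   through (2) and (3). *)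
tfae.
- move=> [N [Cm [A [B [r [r_gt0 [rr0 TE]]]]]]]; apply: rank_of_coef; exists N, Cm, A, B.
  by apply: (coef_of_qprod q n m T r0 q_ge0 q_lt1 convT N Cm A B r) => // z /TE[_ []].
- exact: coef_of_rank.
- by move=> /rank_of_coef/rankP.
- move=> /rankP/coef_of_rank[N [Cm [A [B TE]]]].
  have [r rP] := qprod_of_coef q n m T r0 q_ge0 q_lt1 r0_gt0 N Cm A B TE.
  by exists N, Cm, A, B, r.
Qed.
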